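(* Let $\pi:M(c)\to N$ be an anti-invariant submersion from a quaternionic space form $(M(c),g_M)$ onto a Riemannian manifold $(N,g_N)$, and let $r=\dim\ker\pi_*$. Then for every unit vertical vector $U$ of $M(c)$, $$\widehat{Ric}(U)\ \ge\ \frac{c}{4}(r-1)-r\,g_M(\mathcal T_UU,H).$$ Equality holds (for every unit vertical vector $U$) if and only if each fiber of $\pi$ is totally geodesic.
   Context: An almost quaternionic Hermitian manifold $(M,E,g_M)$ is a $4m$-dimensional Riemannian manifold with a rank 3 subbundle $E\subset \mathrm{End}(TM)$ having, near each point, a local basis $\{J_1,J_2,J_3\}$ of sections with $J_\alpha^2=-\mathrm{id}$, $J_\alpha J_{\alpha+1}=-J_{\alpha+1}J_\alpha=J_{\alpha+2}$ (indices mod 3) and $g_M(J_\alpha X,J_\alpha Y)=g_M(X,Y)$. It is quaternionic Kähler if there are local 1-forms $\omega_1,\omega_2,\omega_3$ with $\nabla_XJ_\alpha=\omega_{\alpha+2}(X)J_{\alpha+1}-\omega_{\alpha+1}(X)J_{\alpha+2}$, $\nabla$ the Levi-Civita connection. A quaternionic space form $M(c)$ ($c\in\mathbb R$) is a quaternionic Kähler manifold whose curvature tensor is $$R(X,Y)Z=\tfrac c4\Big\{g_M(Y,Z)X-g_M(X,Z)Y+\sum_{\alpha=1}^3\big(g_M(J_\alpha Y,Z)J_\alpha X-g_M(J_\alpha X,Z)J_\alpha Y+2g_M(J_\alpha Y,X)J_\alpha Z\big)\Big\}.$$ A Riemannian submersion $\pi:(M,g_M)\to(N,g_N)$ ($\dim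 M>\dim N$) is a smooth surjective map of maximal rank whose differential restricted to $(\ker\pi_* )^\perp$ is a linear isometry. Write $\mathcal V=\ker\pi_*$ (vertical), $\mathcal H=(\ker\pi_* )^\perp$ (horizontal), and use the same letters for the orthogonal projections. The submersion $\pi$ is anti-invariant if $J_\alpha(\ker\pi_* )\subset(\ker\pi_* )^\perp$ for $\alpha=1,2,3$. O'Neill tensor: $\mathcal T_EF=\mathcal H\nabla_{\mathcal VE}\mathcal VF+\mathcal V\nabla_{\mathcal VE}\mathcal HF$. The mean curvature vector field of the fibers is $H=\frac1r\sum_{j=1}^r\mathcal T_{U_j}U_j$ for an orthonormal frame $\{U_1,\dots,U_r\}$ of $\mathcal V$. The fibers are totally geodesic if $\mathcal T$ vanishes identically. Curvature convention: $R(X,Y,Z,W)=g_M(R(X,Y)Z,W)$, and the curvature tensor $\hat R$ of the vertical distribution (fibers) is related to $R$ by $$R(U,V,F,W)=\hat R(U,V,F,W)+g_M(\mathcal T_UW,\mathcal T_VF)-g_M(\mathcal T_VW,\mathcal T_UF)$$ for vertical $U,V,F,W$; the sign of the curvature tensors is the one for which this holds, i.e. $R(X,Y)Z=\nabla_{[X,Y]}Z-\nabla_X\nabla_YZ+\nabla_Y\nabla_XZ$. Finally $\widehat{Ric}(U)=\sum_{i=1}^r\hat R(U,U_i,U_i,U)$. *)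

(* Defs.v *)
From HB Require Import structures.
From mathcomp Require Import all_boot all_order all_algebra.
From mathcomp Require Import boolp classical_sets functions cardinality reals.
From mathcomp Require Import topology normedtype derive.
Set Implicit Arguments.
Unset Strict Implicit.
Unset Printing Implicit Defensive.
Import Order.TTheory GRing.Theory Num.Theory.
Import numFieldNormedType.Exports.
Local Open Scope classical_set_scope.
Local Open Scope ring_scope.

(* Only meant for open sets D. *)
Section smooth.
Context {R : realType} {V W : normedModType R}.

Fixpoint Ck (k : nat) (D : set V) (f : V -> W) : Prop :=
  match k with
  | 0 => forall x, D x -> {for x, continuous f}
  | k.+1 => (forall x, D x -> differentiable f x)
            /\ forall v, Ck k D (fun x => 'D_v f x)
  end.

Definition smooth_on (D : set V) (f : V -> W) : Prop := forall k, Ck k D f.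

End smooth.

Section manifold.
Context (R : realType).

Record chart (M : topologicalType) (n : nat) := Chart {
  chart_dom : set M;
  chart_map : M -> 'rV[R]_n;
  chart_inv : 'rV[R]_n -> M;
  chart_dom_open : open chart_dom;
  chart_image_open : open (chart_map @` chart_dom);
  chart_mapK : forall p, chart_dom p -> chart_inv (chart_map p) = p;
  chart_map_continuous : {within chart_dom, continuous chart_map};
  chart_inv_continuous : {within chart_map @` chart_dom, continuous chart_inv} }.

Record manifold (n : nat) := Manifold {
  space :> topologicalType;
  space_hausdorff : hausdorff_space space;
  space_second_countable : @second_countable space;
  chart_index : Type;
  atlas : chart_index -> chart space n;
  atlas_cover : forall p, exists i, chart_dom (atlas i) p;
  atlas_compatible : forall i j,
    smooth_on (chart_map (atlas i) @` (chart_dom (atlas i) `&` chart_dom (atlas j)))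
              (chart_map (atlas j) \o chart_inv (atlas i)) }.

Definition image_of n (M : manifold n) (i : chart_index M) : set 'rV[R]_n :=
  chart_map (atlas i) @` chart_dom (atlas i).

Definition overlap n (M : manifold n) (i j : chart_index M) : set 'rV[R]_n :=
  chart_map (atlas i) @` (chart_dom (atlas i) `&` chart_dom (atlas j)).

Definition transition n (M : manifold n) (i j : chart_index M) :
  'rV[R]_n -> 'rV[R]_n := chart_map (atlas j) \o chart_inv (atlas i).

(* Domain and coordinate expression of a map between manifolds. *)
Definition local_dom n k (M : manifold n) (N : manifold k) (pi : M -> N)
    (i : chart_index M) (j : chart_index N) : set 'rV[R]_n :=
  chart_map (atlas i) @` (chart_dom (atlas i) `&` pi @^-1` chart_dom (atlas j)).

Definition local_map n k (M : manifold n) (N : manifold k) (pi : M -> N)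
    (i : chart_index M) (j : chart_index N) : 'rV[R]_n -> 'rV[R]_k :=
  chart_map (atlas j) \o pi \o chart_inv (atlas i).

Definition smooth_map n k (M : manifold n) (N : manifold k) (pi : M -> N) :=
  continuous pi /\
  forall i j, smooth_on (local_dom pi i j) (local_map pi i j).

(* Tangent vectors are row vectors of components in a chart.  Endomorphisms
   act on the right, u |-> u *m A, so the endomorphism A o B has matrix
   B *m A; the differential of f at x is u |-> u *m 'J f x. *)
Definition inner n (G : 'M[R]_n) (u v : 'rV[R]_n) : R := (u *m G *m v^T) 0 0.

(* A tensor field on M is given by its components in every chart of the atlas,
   related by the tensor transformation law on overlaps. *)
Record riemannian_metric n (M : manifold n) := RiemannianMetric {
  gmx :> chart_index M -> 'rV[R]_n -> 'M[R]_n;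
  gmx_smooth : forall i, smooth_on (image_of i) (gmx i);
  gmx_sym : forall i x, image_of i x -> (gmx i x)^T = gmx i x;
  gmx_pos : forall i x, image_of i x ->
    forall u : 'rV[R]_n, u != 0 -> 0 < inner (gmx i x) u u;
  gmx_compatible : forall i j x, overlap i j x ->
    gmx i x = 'J (transition i j) x *m gmx j (transition i j x)
              *m ('J (transition i j) x)^T }.

End manifold.

Section local_geometry.
Context {R : realType} {n : nat}.
Implicit Types (G : 'rV[R]_n -> 'M[R]_n) (X Y Z : 'rV[R]_n -> 'rV[R]_n).

Definition lie X Y : 'rV[R]_n -> 'rV[R]_n :=
  fun x => 'D_(X x) Y x - 'D_(Y x) X x.

(* The vector determined by Koszul's formula for constant-coefficient fields,
   2 g(Gamma(u, v), w) = D_u g(v, w) + D_v g(u, w) - D_w g(u, v). *)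
Definition christoffel G (x u v : 'rV[R]_n) : 'rV[R]_n :=
  2^-1 *: ((\row_k ('D_u (fun y => inner (G y) v (delta_mx 0 k)) x
                    + 'D_v (fun y => inner (G y) u (delta_mx 0 k)) x
                    - 'D_(delta_mx 0 k) (fun y => inner (G y) u v) x))
           *m invmx (G x)).

(* Levi-Civita connection; see nabla_torsion_free and nabla_metric. *)
Definition nabla G X Y : 'rV[R]_n -> 'rV[R]_n :=
  fun x => 'D_(X x) Y x + christoffel G x (X x) (Y x).

(* The sign is opposite to the most common one. *)
Definition curvature
    (D : ('rV[R]_n -> 'rV[R]_n) -> ('rV[R]_n -> 'rV[R]_n) ->
         ('rV[R]_n -> 'rV[R]_n)) X Y Z : 'rV[R]_n -> 'rV[R]_n :=
  fun x => D (lie X Y) Z x - D X (D Y Z) x + D Y (D X Z) x.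

Definition endo_app (A : 'rV[R]_n -> 'M[R]_n) X : 'rV[R]_n -> 'rV[R]_n :=
  fun x => X x *m A x.

(* (nabla_X A) Y *)
Definition nabla_endo G X (A : 'rV[R]_n -> 'M[R]_n) Y : 'rV[R]_n -> 'rV[R]_n :=
  fun x => nabla G X (endo_app A Y) x - endo_app A (nabla G X Y) x.

End local_geometry.

Section levi_civita.
Context {R : realType} {n : nat}.
Variables (D : set 'rV[R]_n) (G : 'rV[R]_n -> 'M[R]_n).
Hypotheses (openD : open D) (G_diff : forall x, D x -> differentiable G x).
Hypotheses (G_sym : forall x, D x -> (G x)^T = G x).
Hypotheses (G_pos : forall x, D x ->
  forall u : 'rV[R]_n, u != 0 -> 0 < inner (G x) u u).
Implicit Types (x u v w : 'rV[R]_n) (X Y Z : 'rV[R]_n -> 'rV[R]_n).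

Lemma inner_tr (A : 'M[R]_n) u v : inner A u v = inner A^T v u.
Proof.
by rewrite /inner -[u in LHS]trmxK -[A in LHS]trmxK -mulmxA -!trmx_mul mxE.
Qed.

Lemma inner_sym x u v : D x -> inner (G x) u v = inner (G x) v u.
Proof. by move=> Dx; rewrite inner_tr G_sym. Qed.

Lemma innerDr (A : 'M[R]_n) u v w :
  inner A u (v + w) = inner A u v + inner A u w.
Proof. by rewrite /inner linearD /= mulmxDr mxE. Qed.

Lemma innerDl (A : 'M[R]_n) u v w :
  inner A (u + v) w = inner A u w + inner A v w.
Proof. by rewrite /inner !mulmxDl mxE. Qed.

Lemma G_unit x : D x -> G x \in unitmx.
Proof.
move=> Dx; rewrite -row_free_unit -kermx_eq0; apply/eqP/row_matrixP => i.
rewrite row0; apply/eqP; apply: contraT => /(G_pos Dx).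
have : row i (kermx (G x)) *m G x = 0 by rewrite -row_mul mulmx_ker row0.
by rewrite /inner => ->; rewrite mul0mx mxE ltxx.
Qed.

Lemma is_derive_coord (m p : nat) (F : 'rV[R]_n -> 'M[R]_(m, p)) x w i j :
  derivable F x w -> is_derive x w (fun y => F y i j) ('D_w F x i j).
Proof.
move=> dF; apply: DeriveDef; last by rewrite derive_mx ?mxE.
by move/derivable_mxP: dF; exact.
Qed.

Lemma is_derive_mulmx (m p q : nat) (A : 'rV[R]_n -> 'M[R]_(m, p))
    (B : 'rV[R]_n -> 'M[R]_(p, q)) x w :
  derivable A x w -> derivable B x w ->
  is_derive x w (fun y => A y *m B y) ('D_w A x *m B x + A x *m 'D_w B x).
Proof.
move=> dA dB.
have e i j : is_derive x w (fun y => (A y *m B y) i j)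
    (('D_w A x *m B x + A x *m 'D_w B x) i j).
  have -> : (fun y => (A y *m B y) i j)
      = \sum_k ((fun y => A y i k) * (fun y => B y k j)).
    by apply/funext => y; rewrite mxE fct_sumE.
  rewrite !mxE -big_split /=.
  apply: is_derive_sum => k.
  have dAk := is_derive_coord i k dA; have dBk := is_derive_coord k j dB.
  apply: is_derive_eq.
  by rewrite addrC; congr (_ + _); exact: mulrC.
have dAB : derivable (fun y => A y *m B y) x w.
  by apply/derivable_mxP => i j; case: (e i j).
apply: DeriveDef => //; rewrite derive_mx //.
by apply/matrixP => i j; rewrite mxE; case: (e i j).
Qed.

Lemma derive_inner x w X Y : D x -> derivable X x w -> derivable Y x w ->
  'D_w (fun y => inner (G y) (X y) (Y y)) x
  = inner (G x) ('D_w X x) (Y x) + inner ('D_w G x) (X x) (Y x)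
    + inner (G x) (X x) ('D_w Y x).
Proof.
move=> Dx dX dY; have dG := diff_derivable (v := w) (G_diff Dx).
have [dXG eXG] := is_derive_mulmx dX dG.
have YT i j : (fun y => (Y y)^T i j) = (fun y => Y y j i).
  by apply/funext => y; rewrite mxE.
have dYT : derivable (fun y => (Y y)^T) x w.
  by apply/derivable_mxP => i j; rewrite YT; case: (is_derive_coord j i dY).
have eYT : 'D_w (fun y => (Y y)^T) x = ('D_w Y x)^T.
  rewrite (derive_mx dYT) (derive_mx dY); apply/matrixP => i j.
  by rewrite [LHS]mxE [RHS]mxE [RHS]mxE YT.
have [dR eR] := is_derive_mulmx dXG dYT.
rewrite /inner; have [_ ->] := is_derive_coord 0 0 dR.
by rewrite eR eXG eYT mulmxDl !mxE.
Qed.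

Lemma inner_coord (A : 'M[R]_n) u v :
  inner A u v = \sum_k v 0 k * inner A u (delta_mx 0 k).
Proof.
rewrite /inner [LHS]mxE; apply: eq_bigr => k _.
by rewrite trmx_delta -colE [col _ _ _ _]mxE [v^T _ _]mxE mulrC.
Qed.

Lemma inner_row (r z : 'rV[R]_n) : (r *m z^T) 0 0 = \sum_k z 0 k * r 0 k.
Proof. by rewrite mxE; apply: eq_bigr => k _; rewrite mxE mulrC. Qed.

Lemma derive_inner_cst x u v w : D x ->
  'D_w (fun y => inner (G y) u v) x = inner ('D_w G x) u v.
Proof.
move=> Dx; rewrite (@derive_inner _ _ (cst u) (cst v)) //;
  try exact: derivable_cst.
by rewrite !derive_cst /inner !mul0mx trmx0 mulmx0 !mxE add0r addr0.
Qed.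

Lemma inner_derive_sym x u v w : D x ->
  inner ('D_w G x) u v = inner ('D_w G x) v u.
Proof.
move=> Dx; rewrite -(derive_inner_cst u v w Dx).
rewrite -(derive_inner_cst v u w Dx); apply: near_eq_derive.
by near=> y; apply: inner_sym; near: y; exact: open_nbhs_nbhs.
Unshelve. all: by end_near. Qed.

Lemma inner_christoffel x u v w : D x ->
  2 * inner (G x) (christoffel G x u v) w
  = inner ('D_u G x) v w + inner ('D_v G x) u w - inner ('D_w G x) u v.
Proof.
move=> Dx; rewrite /christoffel {1}/inner -scalemxAl mulmxKV ?G_unit //.
rewrite -scalemxAl [X in 2 * X]mxE mulrA divff ?mul1r ?pnatr_eq0 // inner_row.
have DE : 'D_w G x = \sum_k w 0 k *: 'D_(delta_mx 0 k) G x.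
  rewrite {1}(row_sum_delta w) !deriveE; [|exact: G_diff..].
  rewrite linear_sum; apply: eq_bigr => k _.
  by rewrite linearZ /= deriveE //; exact: G_diff.
under eq_bigr do rewrite mxE !derive_inner_cst // mulrBr mulrDr.
have e : inner ('D_w G x) u v
    = \sum_k w 0 k * inner ('D_(delta_mx 0 k) G x) u v.
  rewrite DE /inner mulmx_sumr mulmx_suml summxE; apply: eq_bigr => k _.
  by rewrite -scalemxAr -scalemxAl [LHS]mxE.
rewrite sumrB big_split /=.
exact: (f_equal2 (fun a b => a - b)
  (f_equal2 +%R (esym (inner_coord _ v w)) (esym (inner_coord _ u w))) (esym e)).
Qed.

Lemma christoffel_sym x u v : D x -> christoffel G x u v = christoffel G x v u.
Proof.
move=> Dx; apply: (congr1 (fun r : 'rV_n => 2^-1 *: (r *m invmx (G x)))).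
apply/rowP => k; rewrite [LHS]mxE [RHS]mxE !derive_inner_cst //.
have e := inner_derive_sym u v (delta_mx 0 k) Dx.
have aux (a b c d : R) : c = d -> a + b - c = b + a - d.
  by move=> ->; rewrite [a + b]addrC.
exact: aux e.
Qed.

Lemma nabla_torsion_free X Y x : D x ->
  nabla G X Y x - nabla G Y X x = lie X Y x.
Proof.
move=> Dx; have e := christoffel_sym (Y x) (X x) Dx.
have aux (a b c d : 'rV[R]_n) : c = d -> (a + d) - (b + c) = a - b.
  by move=> ->; rewrite opprD addrACA subrr addr0.
exact: aux e.
Qed.

Lemma nabla_metric X Y Z x : D x ->
  differentiable Y x -> differentiable Z x ->
  'D_(X x) (fun y => inner (G y) (Y y) (Z y)) x
  = inner (G x) (nabla G X Y x) (Z x) + inner (G x) (Y x) (nabla G X Z x).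
Proof.
move=> Dx dY dZ; rewrite derive_inner //; [|exact: diff_derivable..].
have e1 := inner_christoffel (X x) (Y x) (Z x) Dx.
have e2 := inner_christoffel (X x) (Z x) (Y x) Dx.
have e3 := inner_derive_sym (Z x) (Y x) (X x) Dx.
have e4 := inner_sym (Y x) (christoffel G x (X x) (Z x)) Dx.
have aux (a b p q q' d1 d1' d2 d3 : R) : 2 * p = d1 + d2 - d3 ->
    2 * q = d1' + d3 - d2 -> d1' = d1 -> q' = q ->
    a + d1 + b = a + p + (b + q').
  move=> h1 h2 e -> ; rewrite e in h2.
  have h : p + q = d1.
    apply: (mulfI (_ : 2 != 0 :> R)); first by rewrite pnatr_eq0.
    rewrite mulrDr h1 h2 [2 * d1]mulr_natl mulr2n -[d1 + d2 - d3]addrA.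
    by rewrite -[d1 + d3 - d2]addrA addrACA subrKA subrr addr0.
  by rewrite -h [RHS]addrACA -!addrA [b + _]addrC !addrA.
rewrite /nabla innerDl innerDr; exact: aux e1 e2 e3 e4.
Qed.

End levi_civita.

Section local_submersion.
Context {R : realType} {n k : nat}.
Variables (G : 'rV[R]_n -> 'M[R]_n) (f : 'rV[R]_n -> 'rV[R]_k).
Implicit Types (x u v : 'rV[R]_n) (X Y E F : 'rV[R]_n -> 'rV[R]_n).

(* Row spaces of these matrices: ker df and its G-orthogonal complement. *)
Definition vert x : 'M[R]_n := kermx ('J f x).
Definition horiz x : 'M[R]_n := kermx (G x *m (vert x)^T).

Definition vproj X : 'rV[R]_n -> 'rV[R]_n :=
  fun x => X x *m proj_mx (vert x) (horiz x).
Definition hproj X : 'rV[R]_n -> 'rV[R]_n :=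
  fun x => X x *m proj_mx (horiz x) (vert x).

Definition oneill_T E F : 'rV[R]_n -> 'rV[R]_n :=
  fun x => hproj (nabla G (vproj E) (vproj F)) x
           + vproj (nabla G (vproj E) (hproj F)) x.

(* Connection induced on the fibres. *)
Definition vnabla X Y : 'rV[R]_n -> 'rV[R]_n := vproj (nabla G X Y).

(* Values on tangent vectors at x of the tensors T and hat R: a vector is
   extended to a field with constant components, projected to the vertical
   distribution for hat R, which is defined on vertical fields only. *)
Definition tensorT x u v : 'rV[R]_n := oneill_T (cst u) (cst v) x.

Definition hatR x u v w z : R :=
  inner (G x) (curvature vnabla (vproj (cst u)) (vproj (cst v))
                                (vproj (cst w)) x) z.

Definition orthonormal_vframe x r (e : 'I_r -> 'rV[R]_n) : Prop :=
  [/\ r = \rank (vert x), forall a, (e a <= vert x)%MS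
    & forall a b, inner (G x) (e a) (e b) = (a == b)%:R].

Definition mean_curvature x r (e : 'I_r -> 'rV[R]_n) : 'rV[R]_n :=
  r%:R^-1 *: \sum_a tensorT x (e a) (e a).

Definition hatRic x r (e : 'I_r -> 'rV[R]_n) u : R :=
  \sum_a hatR x u (e a) (e a) u.

End local_submersion.

Section quaternionic.
Context {R : realType} {n : nat} {M : manifold R n}.
Variables (g : riemannian_metric M).
Variable E : chart_index M -> 'rV[R]_n -> {vspace 'M[R]_n}.

(* Indices in 'I_3 are added modulo 3. *)
Definition canonical_basis (i : chart_index M) (W : set 'rV[R]_n)
    (J : 'I_3 -> 'rV[R]_n -> 'M[R]_n) : Prop :=
  [/\ open W, W `<=` image_of i, forall a, smooth_on W (J a)
    & forall x, W x ->
      [/\ basis_of (E i x) [tuple J a x | a < 3],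
          forall a (u : 'rV[R]_n), u *m J a x *m J a x = - u,
          forall a (u : 'rV[R]_n),
            u *m J (a + 1) x *m J a x = u *m J (a + 2%:R) x,
          forall a (u : 'rV[R]_n),
            - (u *m J a x *m J (a + 1) x) = u *m J (a + 2%:R) x
        & forall a u v, inner (g i x) (u *m J a x) (v *m J a x)
                        = inner (g i x) u v]].

Definition almost_quaternionic_hermitian : Prop :=
  (forall i j x, overlap i j x -> forall A B,
     A *m 'J (transition i j) x = 'J (transition i j) x *m B ->
     (A \in E i x) = (B \in E j (transition i j x)))
  /\ forall i x, image_of i x -> exists W J, W x /\ canonical_basis i W J.

(* A 1-form w is given by a column: w(X) = X *m w. *)
Definition quaternionic_kahler : Prop :=
  almost_quaternionic_hermitian /\
  forall i x, image_of i x -> exists W J, [/\ W x, canonical_basis i W J &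
    exists w : 'I_3 -> 'rV[R]_n -> 'cV[R]_n,
      (forall a, smooth_on W (w a)) /\
      forall X Y, smooth_on W X -> smooth_on W Y -> forall a y, W y ->
        nabla_endo (g i) X (J a) Y y
        = (X y *m w (a + 2%:R) y) 0 0 *: endo_app (J (a + 1)) Y y
          - (X y *m w (a + 1) y) 0 0 *: endo_app (J (a + 2%:R)) Y y].

Definition quaternionic_space_form (c : R) : Prop :=
  quaternionic_kahler /\
  forall i W J, canonical_basis i W J ->
  forall X Y Z, smooth_on W X -> smooth_on W Y -> smooth_on W Z ->
  forall x, W x ->
    let ip := inner (g i x) in
    curvature (nabla (g i)) X Y Z x
    = (c / 4) *: (ip (Y x) (Z x) *: X x - ip (X x) (Z x) *: Y x
        + \sum_a (ip (Y x *m J a x) (Z x) *: (X x *m J a x)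
                  - ip (X x *m J a x) (Z x) *: (Y x *m J a x)
                  + (2 * ip (Y x *m J a x) (X x)) *: (Z x *m J a x))).

End quaternionic.

Section submersion.
Context {R : realType} {n k : nat} {M : manifold R n} {N : manifold R k}.
Variables (gM : riemannian_metric M) (gN : riemannian_metric N).
Variable pi : M -> N.

Definition riemannian_submersion : Prop :=
  [/\ (k < n)%N, smooth_map pi, forall q, exists p, pi p = q
    & forall i j x, local_dom pi i j x ->
      let f := local_map pi i j in
      \rank ('J f x) = k /\
      forall u v : 'rV[R]_n,
        (u <= horiz (gM i) f x)%MS -> (v <= horiz (gM i) f x)%MS ->
        inner (gN j (f x)) (u *m 'J f x) (v *m 'J f x) = inner (gM i x) u v].

Definition anti_invariant (E : chart_index M -> 'rV[R]_n -> {vspace 'M[R]_n}) :=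
  forall i j W J, canonical_basis gM E i W J ->
  forall x, W x -> local_dom pi i j x ->
  let f := local_map pi i j in
  forall a (u : 'rV[R]_n), (u <= vert f x)%MS ->
    (u *m J a x <= horiz (gM i) f x)%MS.

Definition totally_geodesic_fibers : Prop :=
  forall i j x, local_dom pi i j x ->
  forall u v, tensorT (gM i) (local_map pi i j) x u v = 0.

End submersion.

(* Main.v *)
From HB Require Import structures.
Require Import Defs.
From mathcomp Require Import all_boot all_order all_algebra.
From mathcomp Require Import boolp classical_sets functions cardinality reals.
From mathcomp Require Import topology normedtype landau derive.
From mathcomp Require Import ring lra.
Import Order.TTheory GRing.Theory Num.Theory.
Import numFieldNormedType.Exports.
Local Open Scope ring_scope.

(** Fix a chart of M and one of N, write f for pi in these charts and let U be
    a unit vertical vector with an orthonormal vertical frame e_a at the same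
    point.  The Gauss equation [gauss] compares the curvature of the fibres with
    that of M:
      hat R(U, e_a, e_a, U) = R(U, e_a, e_a, U) - g(T_U U, T_(e_a) e_a)
                              + g(T_(e_a) U, T_U e_a).
    Since pi is anti-invariant, J_alpha U and J_alpha e_a are horizontal, so all
    the quaternionic terms of R(U, e_a, e_a, U) vanish and the plane spanned by
    U and e_a is as curved as in a real space form of curvature c / 4.  Summing
    over a ([hatRic_vframe]; the sum of the g(U, e_a)^2 is 1 by
    [vframe_parseval]) gives
      hat Ric(U) = c / 4 (r - 1) - r g(T_U U, H) + sum_a |T_U e_a|^2,
    where T_(e_a) U = T_U e_a by [tensorT_sym].  This is the inequality.

    Equality for all unit vertical vectors means that T_U e_a = 0 for all of
    them, hence that T vanishes on pairs of vertical vectors.  For X horizontal,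
    T_U X is vertical and g(T_U X, W) = - g(X, T_U W) by [tensorT_skew], so that
    T vanishes altogether ([tensorT_eq0]).

    Two analytic facts carry the computations.  First, the projections onto the
    vertical and horizontal distributions are smooth, because the horizontal one
    is a rational expression in the metric and the Jacobian of f
    ([hprojE], [smooth_hor_proj]); vertical vectors therefore extend to smooth
    vertical fields, to which the curvature identities apply.  Second, T is
    symmetric on vertical vectors because the vertical distribution is
    involutive ([lie_vert]); as it is the kernel of df, this amounts to the
    symmetry of the second derivatives of f ([schwarz_mx]). *)

Set Implicit Arguments.
Unset Strict Implicit.
Unset Printing Implicit Defensive.

(** * Calculus of C^k maps *)

Section calculus.
Local Open Scope classical_set_scope.
Context {R : realType} {V : normedModType R}.
Implicit Types (W : normedModType R) (D : set V).

(** The Fréchet differential only depends on the germ: the one of f is also a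
    first-order approximation of g, and such an approximation is unique. *)
Lemma near_eq_differentiable {W} (f g : V -> W) x :
  {near x, f =1 g} -> differentiable f x -> differentiable g x.
Proof.
move=> fg df.
have [cdf fE] := (diff_locallyP x f).1 df.
have gE : g \o shift x = cst (g x) + 'd f x +o_ 0 id.
  apply/eqaddoP => /= e e0.
  have /eqaddoP/(_ e e0) := fE.
  have fgx : f x = g x by exact: (nbhs_singleton fg).
  have : \forall y \near 0, f (x + y) = g (x + y) by move/nbhs0P: fg.
  move=> H1 H2; near=> y.
  have /= h1 : f (x + y) = g (x + y) by near: y.
  have h2 : `|(f \o shift x - (cst (f x) + 'd f x)) y| <= e * `|y| by near: y.
  by move: h2; rewrite /= !fctE /= [y + x]addrC h1 fgx.
have dgE := diff_unique cdf gE.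
by apply/diff_locallyP; split; rewrite dgE.
Unshelve. all: by end_near. Qed.

Lemma Ck_sub {W} k D D' (f : V -> W) : D' `<=` D -> Ck k D f -> Ck k D' f.
Proof.
move=> sDD; elim: k f => [|k IH] f /=; first by move=> cf x /sDD; exact: cf.
by move=> [df Cf]; split=> [x /sDD|v]; [exact: df|exact: IH].
Qed.

Lemma open_near_eq {W} D (f g : V -> W) x : open D ->
  (forall y, D y -> f y = g y) -> D x -> {near x, f =1 g}.
Proof.
move=> oD fg Dx; near=> y; apply: fg.
by near: y; exact: open_nbhs_nbhs.
Unshelve. all: by end_near. Qed.

(** The formulas for derivatives below hold only where the maps are
    differentiable, that is on D; this lemma lets the inductions over k use
    them as if they held everywhere. *)
Lemma Ck_eq {W} k D (f g : V -> W) : open D -> (forall x, D x -> f x = g x) ->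
  Ck k D f -> Ck k D g.
Proof.
move=> oD; elim: k f g => [|k IH] f g fg /=.
  move=> cf x Dx; have fgx := open_near_eq oD fg Dx.
  change (g @ x --> g x); rewrite -(fg _ Dx).
  apply: cvg_trans (cf x Dx); apply: near_eq_cvg.
  exact: fgx.
move=> [df Cf]; split=> [x Dx|v].
  exact: near_eq_differentiable (open_near_eq oD fg Dx) (df x Dx).
apply: IH (Cf v) => x Dx; apply: near_eq_derive.
exact: open_near_eq oD fg Dx.
Qed.

Lemma CkW {W} k D (f : V -> W) : Ck k.+1 D f -> Ck k D f.
Proof.
elim: k f => [|k IH] f /= [df Cf].
  by move=> x /df /differentiable_continuous.
by split=> // v; apply: IH; exact: Cf.
Qed.

Lemma Ck_cst {W} k D (a : W) : Ck k D (cst a : V -> W).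
Proof.
elim: k a => [|k IH] a /=; first by move=> x _; exact: cvg_cst.
split=> [x _|v]; first exact: differentiable_cst.
rewrite (_ : (fun x => _) = cst 0) //.
by apply/funext => x; rewrite derive_cst.
Qed.

(** Coordinate projections and the maps a |-> a *: w are continuous and linear;
    this reduces the matrix-valued case to the scalar one. *)
Lemma Ck_linear {W W' : normedModType R} k D (L : {linear W -> W'})
  (f : V -> W) :
  open D -> continuous L -> Ck k D f -> Ck k D (L \o f).
Proof.
move=> oD cL; elim: k f => [|k IH] f /=.
  by move=> cf x Dx; apply: continuous_comp; [exact: cf|exact: cL].
have dL y : differentiable L y by exact: linear_differentiable.
move=> [df Cf]; split=> [x Dx|v].
  by apply: differentiable_comp; [exact: df|exact: dL].
apply: (Ck_eq (f := L \o (fun x => 'D_v f x))) => //; last exact: IH.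
move=> x Dx; have dfx := df x Dx; rewrite /= [RHS]deriveE.
  rewrite diff_comp //= diff_lin // deriveE //.
exact: differentiable_comp.
Qed.

Lemma CkD {W} k D (f g : V -> W) : open D ->
  Ck k D f -> Ck k D g -> Ck k D (fun x => f x + g x).
Proof.
move=> oD; elim: k f g => [|k IH] f g /=.
  by move=> cf cg x Dx; apply: cvgD; [exact: cf|exact: cg].
move=> [df Cf] [dg Cg]; split=> [x Dx|v].
  by apply: differentiableD; [exact: df|exact: dg].
apply: (Ck_eq (f := fun x => 'D_v f x + 'D_v g x)) => //; last exact: IH.
move=> x Dx; rewrite [RHS](@deriveD _ _ _ f g) //.
    exact/diff_derivable/df.
  exact/diff_derivable/dg.
Qed.

Lemma CkM k D (f g : V -> R) : open D ->
  Ck k D f -> Ck k D g -> Ck k D (fun x => f x * g x).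
Proof.
move=> oD; elim: k f g => [|k IH] f g.
  by move=> cf cg x Dx; apply: cvgM; [exact: cf|exact: cg].
move=> Cf Cg; have Cf' := CkW Cf; have Cg' := CkW Cg.
case: Cf Cg => [df Cf] [dg Cg]; split=> [x Dx|v].
  by apply: differentiableM; [exact: df|exact: dg].
apply: (Ck_eq (f := fun x => f x * 'D_v g x + g x * 'D_v f x)) => //.
  move=> x Dx; rewrite [RHS](@deriveM _ _ f g) //.
    exact/diff_derivable/df.
  exact/diff_derivable/dg.
by apply: CkD => //; apply: IH => //; [exact: Cg|exact: Cf].
Qed.

(** The derivative - f^-2 'D_v f contains the inverse itself, at one order of
    differentiability less: hence the induction. *)
Lemma CkV k D (f : V -> R) : open D -> (forall x, D x -> f x != 0) ->
  Ck k D f -> Ck k D (fun x => (f x)^-1).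
Proof.
move=> oD f0; elim: k => [|k IH].
  by move=> cf x Dx; apply: cvgV; [exact: f0|exact: cf].
move=> Cf; have Cf' := IH (CkW Cf); case: Cf => [df Cf]; split=> [x Dx|v].
  by apply: differentiableV; [exact: df|exact: f0].
apply: (Ck_eq (f := fun x => -1 * ((f x)^-1 * (f x)^-1) * 'D_v f x)) => //.
  move=> x Dx; rewrite [RHS](@deriveV _ _ f) ?f0 //.
    by rewrite -exprVn expr2 mulN1r.
  exact/diff_derivable/df.
apply: CkM; [by []| |exact: Cf].
by apply: CkM; [by []|exact: (Ck_cst k D (-1 : R))|apply: CkM].
Qed.

End calculus.

Section matrix_calculus.
Local Open Scope classical_set_scope.
Context {R : realType} {V : normedModType R}.
Variable D : set V.
Hypothesis oD : open D.

Lemma Ck_sum {W : normedModType R} k (I : Type) (s : seq I) (P : pred I)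
    (F : I -> V -> W) :
  (forall i, P i -> Ck k D (F i)) ->
  Ck k D (fun x => \sum_(i <- s | P i) F i x).
Proof.
move=> CF; elim: s => [|i s IH].
  by under eq_fun do rewrite big_nil; exact: (Ck_cst k D (0 : W)).
under eq_fun do rewrite big_cons.
case Pi: (P i) => //; apply: CkD => //; exact: CF.
Qed.

Lemma Ck_prod k (I : Type) (s : seq I) (P : pred I) (F : I -> V -> R) :
  (forall i, P i -> Ck k D (F i)) ->
  Ck k D (fun x => \prod_(i <- s | P i) F i x).
Proof.
move=> CF; elim: s => [|i s IH].
  by under eq_fun do rewrite big_nil; exact: (Ck_cst k D (1 : R)).
under eq_fun do rewrite big_cons.
case Pi: (P i) => //; apply: CkM => //; exact: CF.
Qed.

Lemma Ck_scalel {W : normedModType R} k (f : V -> R) (w : W) :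
  Ck k D f -> Ck k D (fun x => f x *: w).
Proof.
move=> Cf.
have lin : linear ( *:%R ^~ w : R -> _).
  by move=> u y z; rewrite scalerDl scalerA.
pose L : {linear R -> W} := HB.pack ( *:%R ^~ w : R -> W)
  (GRing.isLinear.Build _ _ _ _ _ lin).
by apply: (Ck_linear (L := L)) => //; exact: scalel_continuous.
Qed.

Lemma Ck_coord k m n (F : V -> 'M[R]_(m, n)) i j :
  Ck k D F -> Ck k D (fun x => F x i j).
Proof.
move=> CF.
have lin : linear (fun A : 'M[R]_(m, n) => A i j : R).
  by move=> u y z; rewrite !mxE.
pose L : {linear 'M[R]_(m, n) -> R} :=
  HB.pack (fun A : 'M[R]_(m, n) => A i j : R)
  (GRing.isLinear.Build _ _ _ _ _ lin).
by apply: (Ck_linear (L := L)) => //; exact: coord_continuous.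
Qed.

Lemma Ck_mx k m n (F : V -> 'M[R]_(m, n)) :
  (forall i j, Ck k D (fun x => F x i j)) -> Ck k D F.
Proof.
move=> CF; under [F]eq_fun do rewrite [F _]matrix_sum_delta.
by do 2!apply: Ck_sum => ? _; exact: Ck_scalel.
Qed.

Lemma Ck_mulmx k m n p (A : V -> 'M[R]_(m, n)) (B : V -> 'M[R]_(n, p)) :
  Ck k D A -> Ck k D B -> Ck k D (fun x => A x *m B x).
Proof.
move=> CA CB; apply: Ck_mx => i j; under eq_fun do rewrite mxE.
by apply: Ck_sum => l _; apply: CkM => //; exact: Ck_coord.
Qed.

Lemma Ck_trmx k m n (A : V -> 'M[R]_(m, n)) :
  Ck k D A -> Ck k D (fun x => (A x)^T).
Proof.
move=> CA; apply: Ck_mx => i j; under eq_fun do rewrite mxE.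
exact: Ck_coord.
Qed.

Lemma Ck_scale k m n (f : V -> R) (A : V -> 'M[R]_(m, n)) :
  Ck k D f -> Ck k D A -> Ck k D (fun x => f x *: A x).
Proof.
move=> Cf CA; apply: Ck_mx => i j; under eq_fun do rewrite mxE.
by apply: CkM => //; exact: Ck_coord.
Qed.

Lemma Ck_det k n (A : V -> 'M[R]_n) : Ck k D A -> Ck k D (fun x => \det (A x)).
Proof.
move=> CA; apply: Ck_sum => s _; apply: CkM => //.
  exact: (Ck_cst k D (_ : R)).
by apply: Ck_prod => i _; exact: Ck_coord.
Qed.

(** By Cramer's rule the inverse is a rational function of the entries. *)
Lemma Ck_invmx k n (A : V -> 'M[R]_n) : (forall x, D x -> A x \in unitmx) ->
  Ck k D A -> Ck k D (fun x => invmx (A x)).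
Proof.
move=> uA CA.
apply: (Ck_eq (f := fun x => (\det (A x))^-1 *: \adj (A x))) => //.
  by move=> x Dx; rewrite /invmx uA.
apply: Ck_scale.
  apply: CkV; [by []| |exact: Ck_det].
  by move=> x /uA; rewrite unitmxE unitfE.
apply: Ck_mx => i j; under eq_fun do rewrite mxE /cofactor.
apply: CkM; [by []|exact: (Ck_cst k D (_ : R))|].
apply: Ck_det; apply: Ck_mx => a b; under eq_fun do rewrite !mxE.
exact: Ck_coord.
Qed.

End matrix_calculus.

Section smooth_calculus.
Local Open Scope classical_set_scope.
Context {R : realType} {n : nat}.
Variable D : set 'rV[R]_n.
Hypothesis oD : open D.

Lemma smooth_differentiable {W : normedModType R} (f : 'rV[R]_n -> W) x :
  smooth_on D f -> D x -> differentiable f x.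
Proof. by move=> /(_ 1%N) [df _]; exact: df. Qed.

Lemma smooth_derive {W : normedModType R} (f : 'rV[R]_n -> W) v :
  smooth_on D f -> smooth_on D ('D_v f).
Proof. by move=> Cf k; have [_ ] := Cf k.+1; exact. Qed.

(** By linearity of the differential, 'D_(X x) F is the combination of the
    partial derivatives of F with the components of X as coefficients. *)
Lemma smooth_derive_along p q (F : 'rV[R]_n -> 'M[R]_(p, q))
    (X : 'rV[R]_n -> 'rV[R]_n) :
  smooth_on D F -> smooth_on D X -> smooth_on D (fun x => 'D_(X x) F x).
Proof.
move=> CF CX k.
apply: (Ck_eq (f := fun x => \sum_l X x 0 l *: 'D_(delta_mx 0 l) F x)) => //.
  move=> x Dx; have dF := smooth_differentiable CF Dx.
  rewrite {2}(row_sum_delta (X x)) deriveE // linear_sum; apply: eq_bigr => l _.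
  by rewrite linearZ /= deriveE.
apply: Ck_sum => // l _; apply: Ck_scale => //.
  exact: Ck_coord.
exact: smooth_derive.
Qed.

Lemma smooth_jacobian p (f : 'rV[R]_n -> 'rV[R]_p) :
  smooth_on D f -> smooth_on D (jacobian f).
Proof.
move=> Cf k; apply: Ck_mx => // i j.
apply: (Ck_eq (f := fun x => 'D_(delta_mx 0 i) f x 0 j)) => //.
  move=> x Dx; rewrite deriveEjacobian; last exact: smooth_differentiable Dx.
  by rewrite -rowE mxE.
apply: Ck_coord => //; exact: smooth_derive.
Qed.

End smooth_calculus.

(** * Symmetry of second derivatives *)

Section schwarz.
Local Open Scope classical_set_scope.
Context {R : realType} {V : normedModType R}.
Implicit Types (x y u v : V) (f g : V -> R).

Lemma is_derive_line g y u (t : R) : derivable g (y + t *: u) u ->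
  is_derive t 1 (fun s : R => g (y + s *: u)) ('D_u g (y + t *: u)).
Proof.
move=> dg.
have E : (fun h : R => h^-1 *: (((fun s : R => g (y + s *: u)) \o shift t)
             (h *: (1 : R)) - g (y + t *: u)))
    = (fun h => h^-1 *: ((g \o shift (y + t *: u)) (h *: u) - g (y + t *: u))).
  apply/funext => h /=; rewrite scalerDl [_ *: 1]mulr1.
  by rewrite [y + (_ + _)]addrCA.
by split; [rewrite /derivable E|rewrite /derive E].
Qed.

(** Two applications of the mean value theorem: to the difference of f along
    two sides parallel to u, then to 'D_u f along a segment parallel to v. *)
Lemma second_difference D f x u v (s : R) : Ck 2 D f -> 0 < s ->
  (forall a b, 0 <= a <= s -> 0 <= b <= s -> D (x + a *: u + b *: v)) ->
  exists2 ab : R * R, 0 <= ab.1 <= s /\ 0 <= ab.2 <= s &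
    f (x + s *: u + s *: v) - f (x + s *: u) - f (x + s *: v) + f x
    = s ^+ 2 * 'D_v ('D_u f) (x + ab.1 *: u + ab.2 *: v).
Proof.
move=> [df /(_ u) [dDf _]] s0 sD.
have s_ge0 := ltW s0.
pose phi (t : R) := f (x + s *: v + t *: u) - f (x + t *: u).
have dphi t : 0 <= t <= s -> is_derive t 1 phi
    ('D_u f (x + s *: v + t *: u) - 'D_u f (x + t *: u)).
  move=> ts; apply: is_deriveB; apply: is_derive_line; apply: diff_derivable.
    by apply: df; rewrite addrAC; apply: sD; rewrite ?ts ?lexx ?s_ge0.
  apply: df; rewrite -[_ + _]addr0 -(scale0r v); apply: sD => //.
  by rewrite lexx.
have [a a0s Ea] : exists2 a, a \in `]0, s[%R & phi s - phi 0
    = ('D_u f (x + s *: v + a *: u) - 'D_u f (x + a *: u)) * (s - 0).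
  apply: (MVT s0); first by move=> t ts; apply: dphi; rewrite !ltW ?(itvP ts).
  apply: derivable_within_continuous => t ts.
  by apply: (@ex_derive _ _ _ _ _ _ _ (dphi t _)); rewrite !(itvP ts).
have as_ : 0 <= a <= s by rewrite !ltW ?(itvP a0s).
pose psi (t : R) := 'D_u f (x + a *: u + t *: v).
have dpsi t : 0 <= t <= s ->
    is_derive t 1 psi ('D_v ('D_u f) (x + a *: u + t *: v)).
  move=> ts; apply: is_derive_line; apply: diff_derivable.
  by apply: dDf; apply: sD.
have [b b0s Eb] : exists2 b, b \in `]0, s[%R & psi s - psi 0
    = 'D_v ('D_u f) (x + a *: u + b *: v) * (s - 0).
  apply: (MVT s0); first by move=> t ts; apply: dpsi; rewrite !ltW ?(itvP ts).
  apply: derivable_within_continuous => t ts.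
  by apply: (@ex_derive _ _ _ _ _ _ _ (dpsi t _)); rewrite !(itvP ts).
exists (a, b); first by split=> //=; rewrite !ltW ?(itvP b0s).
move: Ea Eb; rewrite /phi /psi /= !scale0r !addr0 !subr0.
rewrite [x + a *: u + s *: v]addrAC [x + s *: u + s *: v]addrAC => + E.
rewrite {}E => E; lra.
Qed.

Lemma eq_second_difference (p p' q r t : R) :
  p = p' -> p - q - r + t = p' - r - q + t.
Proof. by move=> ->; rewrite (addrAC p'). Qed.

Lemma ler_dist_half (e p q r : R) :
  `|p - q| < e / 2 -> `|r - q| < e / 2 -> `|p - r| <= e.
Proof.
move=> h h'; rewrite -(subrKA q) (le_trans (ler_normD _ _)) //.
by rewrite [e]splitr lerD ?ltW // distrC.
Qed.

(** The second difference of f over a small parallelogram is symmetric in u and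
    v, and equals s^2 times either mixed derivative at some point of it; let
    the parallelogram shrink to x. *)
Lemma schwarz D f x u v : open D -> D x -> Ck 2 D f ->
  'D_u ('D_v f) x = 'D_v ('D_u f) x.
Proof.
move=> oD Dx C2f.
have cD w z : {for x, continuous ('D_w ('D_z f))}.
  by case: (C2f) => _ /(_ z) [_ /(_ w)]; exact.
have c1 := cD u v; have c2 := cD v u.
apply/eqP; rewrite -subr_eq0 -normr_le0; apply/ler_addgt0Pr => e e0.
rewrite add0r.
have e2 : 0 < e / 2 by rewrite divr_gt0.
have nD : nbhs x D by exact: open_nbhs_nbhs.
have near_c (g : V -> R) : {for x, continuous g} ->
    \forall y \near x, `|g x - g y| < e / 2.
  by move/cvgrPdist_lt; exact.
have [d /= d0 dP] := (nbhs_ballP _ _).1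
  (filterI nD (filterI (near_c _ c1) (near_c _ c2))).
(* With this side the parallelogram stays in the ball of radius d. *)
pose s := d / (`|u| + `|v| + 1).
have n0 : 0 < `|u| + `|v| + 1 by rewrite ltr_wpDl ?addr_ge0.
have s0 : 0 < s by rewrite divr_gt0.
have sB a b : 0 <= a <= s -> 0 <= b <= s -> ball x d (x + a *: u + b *: v).
  move=> /andP[a0 as_] /andP[b0 bs]; rewrite -ball_normE /= -addrA opprD addrA.
  rewrite subrr add0r normrN (le_lt_trans (ler_normD _ _)) // !normrZ.
  rewrite !ger0_norm //.
  have -> : d = s * (`|u| + `|v| + 1) by rewrite divfK ?gt_eqF.
  rewrite !mulrDr mulr1; apply: ltr_pwDr => //.
  by rewrite lerD // ler_wpM2r.
have sD a b : 0 <= a <= s -> 0 <= b <= s -> D (x + a *: u + b *: v).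
  by move=> as_ bs; have [//] := dP _ (sB _ _ as_ bs).
have sB' a b : 0 <= a <= s -> 0 <= b <= s -> ball x d (x + a *: v + b *: u).
  by move=> as_ bs; rewrite addrAC; exact: sB.
have sD' a b : 0 <= a <= s -> 0 <= b <= s -> D (x + a *: v + b *: u).
  by move=> as_ bs; have [//] := dP _ (sB' _ _ as_ bs).
have [[a b] /= [as_ bs] E1] := second_difference C2f s0 sD.
have [[a' b'] /= [as' bs'] E2] := second_difference C2f s0 sD'.
have [_ [_ h1]] := dP _ (sB _ _ as_ bs).
have [_ [h2 _]] := dP _ (sB' _ _ as' bs').
have E : 'D_v ('D_u f) (x + a *: u + b *: v)
       = 'D_u ('D_v f) (x + a' *: v + b' *: u).
  apply: (mulfI (_ : s ^+ 2 != 0)); first by rewrite expf_neq0 ?gt_eqF.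
  apply: etrans (esym E1) (etrans _ E2).
  by apply: eq_second_difference; congr (f _); exact: addrAC.
rewrite E in h1.
exact: ler_dist_half h2 h1.
Qed.

Lemma schwarz_mx D p q (F : V -> 'M[R]_(p, q)) x u v : open D -> D x ->
  Ck 2 D F -> 'D_u ('D_v F) x = 'D_v ('D_u F) x.
Proof.
move=> oD Dx C2F.
have E y z i j : ('D_z ('D_y F) x) i j = 'D_z ('D_y (fun t => F t i j)) x.
  case: (C2F) => dF /(_ y) [dDF _].
  rewrite derive_mx; last by apply: diff_derivable; exact: dDF.
  rewrite mxE; apply: near_eq_derive.
  apply: open_near_eq oD _ Dx => t Dt.
  by rewrite derive_mx ?mxE //; apply: diff_derivable; exact: dF.
apply/matrixP => i j; apply: etrans (E v u i j) (etrans _ (esym (E u v i j))).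
by apply: (schwarz _ _ oD Dx); exact: Ck_coord.
Qed.

End schwarz.

(** * Levi-Civita connection *)

Section inner_algebra.
Context {R : realType} {n : nat}.
Implicit Types (A B : 'M[R]_n) (u v w : 'rV[R]_n).

Lemma innerZl A a u v : inner A (a *: u) v = a * inner A u v.
Proof. by rewrite /inner -!scalemxAl mxE. Qed.

Lemma innerZr A a u v : inner A u (a *: v) = a * inner A u v.
Proof. by rewrite /inner linearZ /= -scalemxAr mxE. Qed.

Lemma innerNl A u v : inner A (- u) v = - inner A u v.
Proof. by rewrite -scaleN1r innerZl mulN1r. Qed.

Lemma innerBl A u v w : inner A (u - v) w = inner A u w - inner A v w.
Proof. by rewrite innerDl innerNl. Qed.

Lemma inner0l A v : inner A 0 v = 0.
Proof. by rewrite /inner !mul0mx mxE. Qed.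

Lemma inner0r A v : inner A v 0 = 0.
Proof. by rewrite /inner trmx0 mulmx0 mxE. Qed.

Lemma inner_suml A (I : finType) (F : I -> 'rV[R]_n) w :
  inner A (\sum_i F i) w = \sum_i inner A (F i) w.
Proof. by rewrite /inner !mulmx_suml summxE. Qed.

Lemma inner_sumr A (I : finType) (F : I -> 'rV[R]_n) w :
  inner A w (\sum_i F i) = \sum_i inner A w (F i).
Proof. by rewrite /inner linear_sum mulmx_sumr summxE. Qed.

Lemma inner_linear_mx A B a u v : inner (a *: A + B) u v
  = a * inner A u v + inner B u v.
Proof.
by rewrite /inner mulmxDr mulmxDl mxE -scalemxAr -scalemxAl [X in X + _]mxE.
Qed.

End inner_algebra.

Section levi_civita_calculus.
Local Open Scope classical_set_scope.
Context {R : realType} {n : nat}.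
Variables (D : set 'rV[R]_n) (G : 'rV[R]_n -> 'M[R]_n).
Hypotheses (oD : open D) (sG : smooth_on D G).
Hypotheses (G_sym : forall x, D x -> (G x)^T = G x).
Hypotheses (G_pos : forall x, D x ->
  forall u : 'rV[R]_n, u != 0 -> 0 < inner (G x) u u).
Implicit Types (x u v w : 'rV[R]_n) (X Y Z : 'rV[R]_n -> 'rV[R]_n).

Let dG x (Dx : D x) : differentiable G x := smooth_differentiable sG Dx.

Lemma inner_self_eq0 x u : D x -> inner (G x) u u = 0 -> u = 0.
Proof.
move=> Dx u0; apply/eqP; apply: contraT => /(G_pos Dx).
by rewrite u0 ltxx.
Qed.

Lemma inner_ge0 x u : D x -> 0 <= inner (G x) u u.
Proof.
move=> Dx; have [->|/(G_pos Dx)/ltW//] := eqVneq u 0.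
by rewrite inner0l.
Qed.

Let koszul_linear A Du Dv Dw Dz a u v w z p q r :
  2 * inner A p z = inner Du v z + inner Dv u z - inner Dz u v ->
  2 * inner A q z = inner Du w z + inner Dw u z - inner Dz u w ->
  2 * inner A r z = inner Du (a *: v + w) z + inner (a *: Dv + Dw) u z
                    - inner Dz u (a *: v + w) ->
  inner A (r - (a *: p + q)) z = 0.
Proof.
rewrite innerBl !innerDl innerDr inner_linear_mx !innerZl innerZr => h1 h2 h3.
apply: (mulfI (_ : 2 != 0 :> R)); first by rewrite pnatr_eq0.
rewrite mulr0 mulrBr h3 mulrDr h2 mulrCA h1; ring.
Qed.

(** Koszul's formula is linear in v and determines the vector, as the metric is
    nondegenerate. *)
Lemma christoffel_linear x u a v w : D x ->
  christoffel G x u (a *: v + w)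
  = a *: christoffel G x u v + christoffel G x u w.
Proof.
move=> Dx; apply/eqP; rewrite -subr_eq0; apply/eqP.
apply: (inner_self_eq0 Dx); set z := (X in inner _ _ X).
have E y := inner_christoffel dG G_pos u y z Dx.
have Ezw : 'D_(a *: v + w) G x = a *: 'D_v G x + 'D_w G x.
  by rewrite !deriveE ?linearP; try exact: dG.
have Evw := E (a *: v + w); rewrite Ezw in Evw.
exact: koszul_linear (E v) (E w) Evw.
Qed.

Lemma nabla_linear x X a Y Z : D x -> differentiable Y x ->
  differentiable Z x ->
  nabla G X (fun y => a *: Y y + Z y) x = a *: nabla G X Y x + nabla G X Z x.
Proof.
move=> Dx dY dZ; rewrite /nabla christoffel_linear // scalerDr addrACA.
congr (_ + _); rewrite -deriveZ; last exact: diff_derivable.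
rewrite -deriveD //; first by apply: derivableZ; exact: diff_derivable.
exact: diff_derivable.
Qed.

Lemma nabla_near_eq x X Y Z : D x -> (forall y, D y -> Y y = Z y) ->
  nabla G X Y x = nabla G X Z x.
Proof.
move=> Dx YZ; rewrite /nabla (YZ _ Dx); congr (_ + _).
by apply: near_eq_derive; exact: open_near_eq YZ Dx.
Qed.

Lemma smooth_inner (A : 'rV[R]_n -> 'M[R]_n) X Y : smooth_on D A ->
  smooth_on D X -> smooth_on D Y ->
  smooth_on D (fun x => inner (A x) (X x) (Y x)).
Proof.
move=> sA sX sY k; apply: Ck_coord => //.
by do !apply: Ck_mulmx => //; exact: Ck_trmx.
Qed.

Lemma smooth_invmetric : smooth_on D (fun x => invmx (G x)).
Proof.
by move=> k; apply: Ck_invmx => // x Dx; exact: (G_unit G_pos).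
Qed.

(** In the definition the directions of differentiation are the values of the
    fields; [smooth_derive_along] deals with this dependence on the point. *)
Lemma smooth_christoffel X Y : smooth_on D X -> smooth_on D Y ->
  smooth_on D (fun x => christoffel G x (X x) (Y x)).
Proof.
move=> sX sY k.
apply: Ck_scale => //; first exact: (Ck_cst k D (_ : R)).
apply: Ck_mulmx => //; last exact: smooth_invmetric.
apply: Ck_mx => // i l; under eq_fun do rewrite mxE.
pose c w : 'rV[R]_n -> 'rV[R]_n := cst w.
have sc w : smooth_on D (c w) by move=> ?; exact: Ck_cst.
have sDG W : smooth_on D W -> smooth_on D (fun x => 'D_(W x) G x).
  exact: smooth_derive_along.
apply: (Ck_eq (f := fun x =>
    inner ('D_(X x) G x) (Y x) (c (delta_mx 0 l) x)
  + inner ('D_(Y x) G x) (X x) (c (delta_mx 0 l) x)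
  + -1 * inner ('D_(c (delta_mx 0 l) x) G x) (X x) (Y x))) => //.
  by move=> x Dx; rewrite !(derive_inner_cst dG) // mulN1r.
apply: CkD => //.
  by apply: CkD => //; apply: smooth_inner => //; exact: sDG.
apply: CkM => //; first exact: (Ck_cst k D (_ : R)).
by apply: smooth_inner => //; exact: sDG.
Qed.

Lemma smooth_nabla X Y : smooth_on D X -> smooth_on D Y ->
  smooth_on D (nabla G X Y).
Proof.
move=> sX sY k; apply: CkD => //; first exact: smooth_derive_along.
exact: smooth_christoffel.
Qed.

(** Metric compatibility, for two fields that are orthogonal all along D. *)
Lemma nabla_orth x X Y Z : D x -> differentiable Y x -> differentiable Z x ->
  (forall y, D y -> inner (G y) (Y y) (Z y) = 0) ->
  inner (G x) (nabla G X Y x) (Z x) = - inner (G x) (Y x) (nabla G X Z x).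
Proof.
move=> Dx dY dZ YZ; apply/eqP; rewrite -addr_eq0.
rewrite -(nabla_metric oD dG G_sym G_pos) // -(derive_cst (0 : R) x (X x)).
by apply/eqP/near_eq_derive; exact: open_near_eq YZ Dx.
Qed.

End levi_civita_calculus.

(** * Vertical and horizontal distributions *)

Section submersion_geometry.
Local Open Scope classical_set_scope.
Context {R : realType} {n k : nat}.
Variables (D : set 'rV[R]_n) (G : 'rV[R]_n -> 'M[R]_n).
Variable f : 'rV[R]_n -> 'rV[R]_k.
Hypotheses (oD : open D) (sG : smooth_on D G).
Hypotheses (G_sym : forall x, D x -> (G x)^T = G x).
Hypotheses (G_pos : forall x, D x ->
  forall u : 'rV[R]_n, u != 0 -> 0 < inner (G x) u u).
Hypotheses (sf : smooth_on D f).
Hypothesis rank_f : forall x, D x -> \rank ('J f x) = k.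
Implicit Types (x u v w z : 'rV[R]_n) (X Y Z : 'rV[R]_n -> 'rV[R]_n).

Let dG x (Dx : D x) : differentiable G x := smooth_differentiable sG Dx.
Let G_inj x u (Dx : D x) := @inner_self_eq0 R n D G G_pos x u Dx.

(** The inner product that f induces on covectors of its target; its inverse
    makes 'J f x isometric on horizontal vectors. *)
Definition gram x : 'M[R]_k := ('J f x)^T *m invmx (G x) *m 'J f x.

(** If w is in the kernel, the vector w *m ('J f)^T *m G^-1 has length zero;
    since 'J f has full rank, w = 0. *)
Lemma gram_unit x : D x -> gram x \in unitmx.
Proof.
move=> Dx; have uG := G_unit G_pos Dx.
rewrite -row_free_unit -kermx_eq0; apply/eqP/row_matrixP => i.
rewrite row0; set w := row i _.
have w0 : w *m gram x = 0 by rewrite -row_mul mulmx_ker row0.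
have : w *m ('J f x)^T *m invmx (G x) = 0.
  apply: (G_inj Dx); rewrite /inner mulmxKV //.
  rewrite !trmx_mul trmxK trmx_inv G_sym // !mulmxA.
  by move: w0; rewrite /gram !mulmxA => ->; rewrite mul0mx mxE.
move/(congr1 (mulmx^~ (G x))); rewrite mulmxKV // mul0mx.
rewrite -[RHS](mul0mx _ ('J f x)^T); apply: row_free_inj.
by rewrite /row_free mxrank_tr rank_f.
Qed.

(** The differential, followed by the horizontal lift
    w |-> w *m (gram x)^-1 *m ('J f x)^T *m (G x)^-1. *)
Definition hor_proj x : 'M[R]_n :=
  'J f x *m invmx (gram x) *m ('J f x)^T *m invmx (G x).

Lemma vert_horiz_orth x u v : D x ->
  (u <= vert f x)%MS -> (v <= horiz G f x)%MS -> inner (G x) u v = 0.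
Proof.
move=> Dx /submxP[a ->] /sub_kermxP v0; rewrite (inner_sym G_sym) // /inner.
rewrite (trmx_mul a) (mulmxA (v *m G x)) -(mulmxA v (G x)) v0.
by rewrite mul0mx mxE.
Qed.

(** A vector in both spaces is orthogonal to itself. *)
Lemma vert_horiz_cap x : D x -> (vert f x :&: horiz G f x)%MS = 0.
Proof.
move=> Dx; apply/row_matrixP => i; rewrite row0; apply: (G_inj Dx).
by apply: vert_horiz_orth => //; rewrite (submx_trans (row_sub _ _)) //
   ?capmxSl ?capmxSr.
Qed.

Lemma hor_proj_horiz x : D x -> (hor_proj x <= horiz G f x)%MS.
Proof.
move=> Dx; apply/sub_kermxP; rewrite /hor_proj !mulmxA.
rewrite mulmxKV ?(G_unit G_pos) //.
by rewrite -!mulmxA -trmx_mul mulmx_ker trmx0 !mulmx0.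
Qed.

Lemma hor_proj_compl_vert x : D x -> (1%:M - hor_proj x <= vert f x)%MS.
Proof.
move=> Dx; apply/sub_kermxP; rewrite mulmxBl mul1mx /hor_proj -!mulmxA.
rewrite (mulmxA _ (invmx (G x))) -/(gram x) mulVmx ?gram_unit //.
by rewrite mulmx1 subrr.
Qed.

(** The rows of [hor_proj] are horizontal and those of 1 - [hor_proj] are
    vertical, which characterizes the projection. *)
Lemma hprojE X x : D x -> hproj G f X x = X x *m hor_proj x.
Proof.
move=> Dx; have cap0 := vert_horiz_cap Dx; have cap0' := cap0.
rewrite capmxC in cap0'; rewrite /hproj.
have {1}-> : X x = X x *m hor_proj x + X x *m (1%:M - hor_proj x).
  by rewrite -mulmxDr addrC subrK mulmx1.
rewrite mulmxDl proj_mx_id //; last first.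
  exact: submx_trans (submxMl _ _) (hor_proj_horiz Dx).
rewrite proj_mx_0 ?addr0 //.
exact: submx_trans (submxMl _ _) (hor_proj_compl_vert Dx).
Qed.

Lemma vprojE X x : D x -> vproj G f X x = X x *m (1%:M - hor_proj x).
Proof.
move=> Dx; have cap0 := vert_horiz_cap Dx; rewrite /vproj.
have {1}-> : X x = X x *m hor_proj x + X x *m (1%:M - hor_proj x).
  by rewrite -mulmxDr addrC subrK mulmx1.
rewrite mulmxDl proj_mx_0 ?add0r //; last first.
  exact: submx_trans (submxMl _ _) (hor_proj_horiz Dx).
rewrite proj_mx_id //.
exact: submx_trans (submxMl _ _) (hor_proj_compl_vert Dx).
Qed.

Lemma vproj_vert X x : (vproj G f X x <= vert f x)%MS.
Proof. exact: proj_mx_sub. Qed.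

Lemma hproj_horiz X x : (hproj G f X x <= horiz G f x)%MS.
Proof. exact: proj_mx_sub. Qed.

Lemma vproj_hproj_orth X Y x : D x ->
  inner (G x) (vproj G f X x) (hproj G f Y x) = 0.
Proof.
move=> Dx; apply: vert_horiz_orth => //; first exact: vproj_vert.
exact: hproj_horiz.
Qed.

Lemma hproj_vproj_orth X Y x : D x ->
  inner (G x) (hproj G f X x) (vproj G f Y x) = 0.
Proof. by move=> Dx; rewrite (inner_sym G_sym) // vproj_hproj_orth. Qed.

Lemma vproj_hproj X x : D x -> vproj G f X x + hproj G f X x = X x.
Proof.
by move=> Dx; rewrite vprojE // hprojE // -mulmxDr subrK mulmx1.
Qed.

Lemma vproj_id X x : D x -> (X x <= vert f x)%MS -> vproj G f X x = X x.
Proof. by move=> Dx; apply: proj_mx_id; exact: vert_horiz_cap. Qed.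

Lemma hproj_id X x : D x -> (X x <= horiz G f x)%MS -> hproj G f X x = X x.
Proof.
by move=> Dx; apply: proj_mx_id; rewrite capmxC; exact: vert_horiz_cap.
Qed.

Lemma vproj_0 X x : D x -> (X x <= horiz G f x)%MS -> vproj G f X x = 0.
Proof. by move=> Dx; apply: proj_mx_0; exact: vert_horiz_cap. Qed.

Lemma hproj_0 X x : D x -> (X x <= vert f x)%MS -> hproj G f X x = 0.
Proof.
by move=> Dx; apply: proj_mx_0; rewrite capmxC; exact: vert_horiz_cap.
Qed.

Lemma inner_vproj X x z : D x -> (z <= vert f x)%MS ->
  inner (G x) (vproj G f X x) z = inner (G x) (X x) z.
Proof.
move=> Dx zv; rewrite -[in RHS](vproj_hproj X Dx) innerDl.
rewrite [X in _ + X](inner_sym G_sym) // (vert_horiz_orth Dx zv) ?addr0 //.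
exact: hproj_horiz.
Qed.

Lemma inner_hproj X x z : D x -> (z <= horiz G f x)%MS ->
  inner (G x) z (hproj G f X x) = inner (G x) z (X x).
Proof.
move=> Dx zh; rewrite -[in RHS](vproj_hproj X Dx) innerDr.
rewrite [X in X + _](inner_sym G_sym) // (vert_horiz_orth Dx _ zh) ?add0r //.
exact: vproj_vert.
Qed.

Lemma smooth_hor_proj : smooth_on D hor_proj.
Proof.
have sJ := smooth_jacobian oD sf.
have sI := smooth_invmetric oD sG G_pos.
move=> l; do ![apply: Ck_mulmx => //]; last exact: Ck_trmx.
apply: Ck_invmx => //; first exact: gram_unit.
by do ![apply: Ck_mulmx => //]; exact: Ck_trmx.
Qed.

Lemma smooth_hproj X : smooth_on D X -> smooth_on D (hproj G f X).
Proof.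
move=> sX l; apply: (Ck_eq (f := fun x => X x *m hor_proj x)) => //.
  by move=> x Dx; rewrite hprojE.
by apply: Ck_mulmx => //; exact: smooth_hor_proj.
Qed.

Lemma smooth_vproj X : smooth_on D X -> smooth_on D (vproj G f X).
Proof.
move=> sX l; apply: (Ck_eq (f := fun x => X x + -1 *: hproj G f X x)) => //.
  by move=> x Dx; rewrite -[X in X + _](vproj_hproj X Dx) scaleN1r addrK.
apply: CkD => //; apply: Ck_scale => //; first exact: (Ck_cst l D (_ : R)).
exact: smooth_hproj.
Qed.

Lemma smooth_vcst u : smooth_on D (vproj G f (cst u)).
Proof. by apply: smooth_vproj => l; exact: Ck_cst. Qed.

Lemma vcstE x u : D x -> (u <= vert f x)%MS -> vproj G f (cst u) x = u.
Proof. by move=> Dx ux; rewrite vproj_id. Qed.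

Let dsm (X : 'rV[R]_n -> 'rV[R]_n) (sX : smooth_on D X) x (Dx : D x)
  : differentiable X x := smooth_differentiable sX Dx.
Let scst u : smooth_on D (cst u : 'rV[R]_n -> 'rV[R]_n) :=
  fun l => Ck_cst l D u.

Lemma nabla_congr_dir X X' Y x : X x = X' x -> nabla G X Y x = nabla G X' Y x.
Proof. by rewrite /nabla => ->. Qed.

(** * O'Neill tensor and Gauss equation *)

(** The other component of T_u v is zero: the field of horizontal parts of v
    vanishes at x, and its covariant derivative is paired with vertical fields,
    to which it is orthogonal. *)
Lemma tensorTE x u v : D x -> (v <= vert f x)%MS ->
  tensorT G f x u v
  = hproj G f (nabla G (vproj G f (cst u)) (vproj G f (cst v))) x.
Proof.
move=> Dx vx; rewrite /tensorT /oneill_T -[RHS]addr0; congr (_ + _).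
set z := vproj _ _ _ x.
have zx : (z <= vert f x)%MS by exact: vproj_vert.
apply: (inner_self_eq0 G_pos Dx).
rewrite {1}/z inner_vproj //.
rewrite -{1}(vcstE Dx zx).
rewrite (nabla_orth oD sG G_sym G_pos) //; last first.
- by move=> y Dy; exact: hproj_vproj_orth.
- exact: dsm (smooth_vcst z) _ Dx.
- exact: dsm (smooth_hproj (scst v)) _ Dx.
by rewrite hproj_0 // inner0l oppr0.
Qed.

(** Differentiating 0 = Y *m 'J f along X gives df('D_X Y) = - D^2 f(X, Y), and
    the right-hand side is symmetric in X and Y. *)
Lemma lie_vert X Y x : D x -> smooth_on D X -> smooth_on D Y ->
  (forall y, D y -> (X y <= vert f y)%MS) ->
  (forall y, D y -> (Y y <= vert f y)%MS) ->
  (lie X Y x <= vert f x)%MS.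
Proof.
move=> Dx sX sY Xv Yv.
have sJ := smooth_jacobian oD sf.
(* Differentiate 0 = Z *m 'J f along w. *)
have E Z w : smooth_on D Z -> (forall y, D y -> (Z y <= vert f y)%MS) ->
    'D_w Z x *m 'J f x = - 'D_w ('D_(Z x) f) x.
  move=> sZ Zv; have dZ : derivable Z x w.
    by apply: diff_derivable; exact: smooth_differentiable Dx.
  have dJ : derivable (jacobian f) x w.
    by apply: diff_derivable; exact: smooth_differentiable Dx.
  have [_ e1] := is_derive_mulmx dZ dJ.
  have [_ e2] := is_derive_mulmx (derivable_cst (Z x) x w) dJ.
  have {}e1 : 0 = 'D_w Z x *m 'J f x + Z x *m 'D_w (jacobian f) x.
    rewrite -e1 -(derive_cst (0 : 'rV[R]_k) x w); apply: near_eq_derive.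
    apply: open_near_eq oD _ Dx => y Dy /=.
    by have /sub_kermxP -> := Zv y Dy.
  rewrite derive_cst mul0mx add0r in e2.
  apply/eqP; rewrite -addr_eq0 [X in _ == X]e1 -e2; apply/eqP; congr (_ + _).
  apply: near_eq_derive; apply: open_near_eq oD _ Dx => y Dy /=.
  by rewrite deriveEjacobian //; exact: smooth_differentiable Dy.
apply/sub_kermxP; rewrite /lie mulmxBl !E // opprK addrC.
by apply/eqP; rewrite subr_eq0; apply/eqP; apply: schwarz_mx oD Dx (sf 2).
Qed.

(** The connection is torsion free and the bracket of vertical fields has no
    horizontal part. *)
Lemma tensorT_sym x u v : D x -> (u <= vert f x)%MS -> (v <= vert f x)%MS ->
  tensorT G f x u v = tensorT G f x v u.
Proof.
move=> Dx ux vx; rewrite (tensorTE u Dx vx) (tensorTE v Dx ux).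
apply/eqP; rewrite -subr_eq0; apply/eqP.
rewrite /hproj -mulmxBl (nabla_torsion_free oD dG G_sym) //.
apply: hproj_0 => //.
apply: (lie_vert Dx (smooth_vcst u) (smooth_vcst v)) => y _.
  exact: vproj_vert.
exact: vproj_vert.
Qed.

Lemma tensorT_linear x u a v w : D x ->
  tensorT G f x u (a *: v + w) = a *: tensorT G f x u v + tensorT G f x u w.
Proof.
move=> Dx; rewrite /tensorT /oneill_T.
have Ev : vproj G f (cst (a *: v + w))
    = fun y => a *: vproj G f (cst v) y + vproj G f (cst w) y.
  by apply/funext => y; rewrite /vproj /cst mulmxDl -scalemxAl.
have Eh : hproj G f (cst (a *: v + w))
    = fun y => a *: hproj G f (cst v) y + hproj G f (cst w) y.
  by apply/funext => y; rewrite /hproj /cst mulmxDl -scalemxAl.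
have ev := nabla_linear sG G_pos (vproj G f (cst u)) a Dx
  (dsm (smooth_vcst v) Dx) (dsm (smooth_vcst w) Dx).
have eh := nabla_linear sG G_pos (vproj G f (cst u)) a Dx
  (dsm (smooth_hproj (scst v)) Dx) (dsm (smooth_hproj (scst w)) Dx).
rewrite Ev Eh; have aux (P Q : 'M[R]_n) (p q p' q' : 'rV[R]_n) :
    (a *: p + q) *m P + (a *: p' + q') *m Q
    = a *: (p *m P + p' *m Q) + (q *m P + q' *m Q).
  by rewrite !mulmxDl -!scalemxAl scalerDr addrACA.
apply: etrans (f_equal2 (fun p q => p *m proj_mx (horiz G f x) (vert f x)
  + q *m proj_mx (vert f x) (horiz G f x)) ev eh) _; exact: aux.
Qed.

Lemma tensorT0 x u : D x -> tensorT G f x u 0 = 0.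
Proof.
move=> Dx; have := tensorT_linear u (-1) 0 0 Dx.
by rewrite scaler0 addr0 scaleN1r addNr.
Qed.

Lemma inner_nabla_vert x u v z : D x -> (v <= vert f x)%MS ->
  (z <= horiz G f x)%MS ->
  inner (G x) z (nabla G (vproj G f (cst u)) (vproj G f (cst v)) x)
  = inner (G x) z (tensorT G f x u v).
Proof. by move=> Dx vx zx; rewrite tensorTE // inner_hproj. Qed.

(** The horizontal component is zero because the field of vertical parts of v
    vanishes at x and stays orthogonal to horizontal fields; the identity
    differentiates the orthogonality of horizontal and vertical fields. *)
Lemma tensorT_skew x u v : D x -> (v <= horiz G f x)%MS ->
  (tensorT G f x u v <= vert f x)%MS /\
  forall z, (z <= vert f x)%MS ->
  inner (G x) (tensorT G f x u v) z = - inner (G x) v (tensorT G f x u z).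
Proof.
move=> Dx vx; rewrite {1 2}/tensorT /oneill_T.
have -> : hproj G f (nabla G (vproj G f (cst u)) (vproj G f (cst v))) x = 0.
  set h := hproj _ _ _ x.
  have hx : (h <= horiz G f x)%MS by exact: hproj_horiz.
  apply: (inner_self_eq0 G_pos Dx).
  rewrite {2}/h inner_hproj // (inner_sym G_sym) //.
  have hE : hproj G f (cst h) x = h by exact: hproj_id.
  rewrite -{1}hE.
  rewrite (nabla_orth oD sG G_sym G_pos) //; last first.
  - by move=> y Dy; exact: vproj_hproj_orth.
  - exact: dsm (smooth_hproj (scst h)) _ Dx.
  - exact: dsm (smooth_vcst v) _ Dx.
  by rewrite vproj_0 // inner0l oppr0.
rewrite add0r; split; first exact: vproj_vert.
move=> z zx; rewrite inner_vproj //.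
rewrite -{1}(vcstE Dx zx).
rewrite (nabla_orth oD sG G_sym G_pos) //; last first.
- by move=> y Dy; exact: hproj_vproj_orth.
- exact: dsm (smooth_vcst z) _ Dx.
- exact: dsm (smooth_hproj (scst v)) _ Dx.
by rewrite hproj_id // inner_nabla_vert.
Qed.

Lemma tensorT_vproj x u v : D x ->
  tensorT G f x u v = tensorT G f x (vproj G f (cst u) x) v.
Proof.
move=> Dx; set w := vproj G f (cst u) x.
have wx : (w <= vert f x)%MS by exact: vproj_vert.
have E : vproj G f (cst u) x = vproj G f (cst w) x.
  by rewrite (vcstE Dx wx).
by rewrite /tensorT /oneill_T /hproj /vproj !(nabla_congr_dir _ E).
Qed.

(** Split v into a vertical and a horizontal part; T of the latter is vertical
    and its products with vertical vectors are values of T on vertical pairs. *)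
Lemma tensorT_eq0 x : D x ->
  (forall u v, (u <= vert f x)%MS -> (v <= vert f x)%MS ->
     tensorT G f x u v = 0) ->
  forall u v, tensorT G f x u v = 0.
Proof.
move=> Dx T0 u v; rewrite tensorT_vproj //.
set w := vproj G f (cst u) x.
have wx : (w <= vert f x)%MS by exact: vproj_vert.
have <- : vproj G f (cst v) x + hproj G f (cst v) x = v by exact: vproj_hproj.
set p := vproj _ _ _ x; set q := hproj _ _ _ x.
have [Tv Ts] := tensorT_skew w Dx (hproj_horiz (cst v) x).
rewrite -[p]scale1r tensorT_linear // T0 ?scaler0 ?add0r //; last first.
  exact: vproj_vert.
apply: (inner_self_eq0 G_pos Dx).
by rewrite Ts // T0 // inner0r oppr0.
Qed.

(** The curvatures of [nabla] and [vnabla] differ by the horizontal part of the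
    inner covariant derivatives; moving the outer derivative to the other factor
    of the inner product turns it into products of values of T. *)
Lemma gauss x u v w z : D x -> (u <= vert f x)%MS -> (v <= vert f x)%MS ->
  (w <= vert f x)%MS -> (z <= vert f x)%MS ->
  let U := vproj G f (cst u) in let V := vproj G f (cst v) in
  let W := vproj G f (cst w) in
  inner (G x) (curvature (nabla G) U V W x) z
  = hatR G f x u v w z
    + inner (G x) (tensorT G f x u z) (tensorT G f x v w)
    - inner (G x) (tensorT G f x v z) (tensorT G f x u w).
Proof.
move=> Dx ux vx wx zx U V W.
have sW : smooth_on D W := smooth_vcst w.
have split_nabla a b : (b <= vert f x)%MS ->
  inner (G x) (nabla G (vproj G f (cst a))
                (nabla G (vproj G f (cst b)) W) x) z
  = inner (G x) (vproj G f (nabla G (vproj G f (cst a))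
       (vproj G f (nabla G (vproj G f (cst b)) W))) x) z
    - inner (G x) (tensorT G f x a z) (tensorT G f x b w).
  move=> bx; set A := vproj G f (cst a); set B := vproj G f (cst b).
  have sBW : smooth_on D (nabla G B W).
    exact: (smooth_nabla oD sG G_pos (smooth_vcst b)).
  have dv := dsm (smooth_vproj sBW) Dx.
  have dh := dsm (smooth_hproj sBW) Dx.
  rewrite inner_vproj //.
  rewrite (nabla_near_eq G (Z := fun y => 1 *: vproj G f (nabla G B W) y
     + hproj G f (nabla G B W) y) oD A Dx); last first.
    by move=> y Dy; rewrite scale1r vproj_hproj.
  rewrite (nabla_linear sG G_pos _ _ Dx dv dh) scale1r innerDl.
  congr (_ + _).
  rewrite -{1}(vcstE Dx zx).
  rewrite (nabla_orth oD sG G_sym G_pos) //; last first.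
  - by move=> y Dy; exact: hproj_vproj_orth.
  - exact: dsm (smooth_vcst z) _ Dx.
  rewrite (tensorTE b Dx wx) (inner_nabla_vert _ Dx zx (hproj_horiz _ _)).
  by congr (- _); exact: (inner_sym G_sym).
have aux a a' b b' c c' p q : inner (G x) a z = inner (G x) a' z ->
    inner (G x) b z = inner (G x) b' z - p ->
    inner (G x) c z = inner (G x) c' z - q ->
    inner (G x) (a - b + c) z = inner (G x) (a' - b' + c') z + p - q.
  by rewrite !innerDl !innerNl => -> -> ->; ring.
exact: aux (esym (inner_vproj _ Dx zx)) (split_nabla u v vx)
  (split_nabla v u ux).
Qed.

(** * Ricci curvature of the fibres *)

(** An orthonormal family has an invertible Gram matrix, so it is free, and it
    spans the vertical space, as it has as many elements as the dimension. *)
Lemma vframe_expansion x r (e : 'I_r -> 'rV[R]_n) u : D x ->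
  orthonormal_vframe G f x e -> (u <= vert f x)%MS ->
  u = \sum_a inner (G x) u (e a) *: e a.
Proof.
move=> Dx [rE ev eE] ux.
pose B := \matrix_a e a.
(* Orthonormality says that the Gram matrix of the rows of B is 1. *)
have BGB : B *m G x *m B^T = 1%:M.
  apply/matrixP => a b; rewrite [RHS]mxE -eE /inner !mxE; apply: eq_bigr => l _.
  rewrite !mxE; congr (_ * _); apply: eq_bigr => l' _.
  by rewrite !mxE.
have rB : \rank B = r.
  apply/eqP; apply: (inj_row_free (A := B)) => w wB.
  by rewrite -[w]mulmx1 -BGB !mulmxA wB !mul0mx.
have sB : (B <= vert f x)%MS by apply/row_subP => a; rewrite rowK.
have : (u <= B)%MS.
  by apply: submx_trans ux _; rewrite -(mxrank_leqif_sup sB).2 rB -rE.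
move=> /submxP[w wE].
have uE : u = \sum_a w 0 a *: e a.
  by rewrite wE mulmx_sum_row; apply: eq_bigr => a _; rewrite rowK.
rewrite {1}uE; apply: eq_bigr => b _; congr (_ *: _).
rewrite uE inner_suml (bigD1 b) //= innerZl eE eqxx mulr1 big1 ?addr0 //.
by move=> a ab; rewrite innerZl eE (negbTE ab) mulr0.
Qed.

Lemma vframe_parseval x r (e : 'I_r -> 'rV[R]_n) u : D x ->
  orthonormal_vframe G f x e -> (u <= vert f x)%MS ->
  \sum_a inner (G x) u (e a) ^+ 2 = inner (G x) u u.
Proof.
move=> Dx he ux; rewrite {3}(vframe_expansion Dx he ux) inner_sumr.
by apply: eq_bigr => a _; rewrite innerZr expr2.
Qed.

Lemma tensorT_eq0_vframe x r (e : 'I_r -> 'rV[R]_n) u v : D x ->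
  orthonormal_vframe G f x e -> (v <= vert f x)%MS ->
  (forall a, tensorT G f x u (e a) = 0) -> tensorT G f x u v = 0.
Proof.
move=> Dx he vx T0; rewrite (vframe_expansion Dx he vx).
apply: (big_ind (fun w => tensorT G f x u w = 0)).
- exact: tensorT0.
- move=> w w' w0 w0'; rewrite -[w]scale1r tensorT_linear //.
  by rewrite w0 w0' scaler0 addr0.
- move=> a _; rewrite -[X in tensorT _ _ _ _ X]addr0 tensorT_linear // T0.
  by rewrite scaler0 add0r tensorT0.
Qed.

(** The sum of the Gauss equations over the frame, when every plane
    spanned by u and a frame vector has sectional curvature c. *)
Lemma hatRic_vframe x r (e : 'I_r -> 'rV[R]_n) u (c : R) : D x ->
  orthonormal_vframe G f x e -> (u <= vert f x)%MS -> inner (G x) u u = 1 ->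
  (forall a, let U := vproj G f (cst u) in let V := vproj G f (cst (e a)) in
     inner (G x) (curvature (nabla G) U V V x) u
     = c * (1 - inner (G x) u (e a) ^+ 2)) ->
  hatRic G f x e u
  = c * (r%:R - 1)
    - r%:R * inner (G x) (tensorT G f x u u) (mean_curvature G f x e)
    + \sum_a inner (G x) (tensorT G f x u (e a)) (tensorT G f x u (e a)).
Proof.
move=> Dx he ux u1 hc; have [rE ev eE] := he.
(* For r = 0 both sides vanish, in spite of the factor r^-1 in the mean
   curvature. *)
have mcE : r%:R * inner (G x) (tensorT G f x u u) (mean_curvature G f x e)
    = \sum_a inner (G x) (tensorT G f x u u) (tensorT G f x (e a) (e a)).
  rewrite /mean_curvature innerZr inner_sumr.
  have [r0|r0] := eqVneq r 0%N.
    rewrite big1 ?mulr0 // => a _; have := ltn_ord a.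
    by rewrite [X in (_ < X)%N]r0.
  by rewrite mulVKf // pnatr_eq0.
have parseval := vframe_parseval Dx he ux.
have step a : hatR G f x u (e a) (e a) u =
    c * (1 - inner (G x) u (e a) ^+ 2)
    - inner (G x) (tensorT G f x u u) (tensorT G f x (e a) (e a))
    + inner (G x) (tensorT G f x u (e a)) (tensorT G f x u (e a)).
  have aux (l h p q k' : R) : l = h + p - q -> l = k' -> h = k' - p + q.
    by move=> -> <-; ring.
  have := aux _ _ _ _ _ (gauss Dx ux (ev a) (ev a) ux) (hc a).
  by rewrite (tensorT_sym Dx (ev a) ux).
rewrite /hatRic (eq_bigr _ (fun a _ => step a)) big_split /= sumrB mcE.
congr (_ - _ + _); rewrite -mulr_sumr sumrB parseval u1.
by rewrite big_const_ord iter_addr_0.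
Qed.

End submersion_geometry.

(** * Charts and canonical bases *)

Section charts.
Local Open Scope classical_set_scope.
Context {R : realType} {n k : nat} {M : manifold R n} {N : manifold R k}.
Variable pi : M -> N.

Lemma local_dom_image i j : local_dom pi i j `<=` image_of i.
Proof. by move=> _ [p [Dp _] <-]; exists p. Qed.

(** Near a point of the domain, it is the preimage of an open set under the
    inverse of the chart. *)
Lemma open_local_dom i j : continuous pi -> open (local_dom pi i j).
Proof.
move=> cpi; rewrite openE => x Dx; have [p [Dp Dpi] px] := Dx.
have oI : open (image_of i) by exact: chart_image_open.
have ix : image_of i x by exact: local_dom_image Dx.
have nI : nbhs x (image_of i) by exact: open_nbhs_nbhs.
have cinv : {for x, continuous (chart_inv (atlas i))}.
  have := chart_inv_continuous (c := atlas i).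
  rewrite continuous_open_subspace // => ci; apply: ci.
  by rewrite inE.
have pE : chart_inv (atlas i) x = p by rewrite -px chart_mapK.
have oS : open (chart_dom (atlas i) `&` pi @^-1` chart_dom (atlas j)).
  apply: openI; first exact: chart_dom_open.
  by apply: open_comp => [q _|]; [exact: cpi|exact: chart_dom_open].
have nS : nbhs (chart_inv (atlas i) x)
    (chart_dom (atlas i) `&` pi @^-1` chart_dom (atlas j)).
  by rewrite pE; apply: open_nbhs_nbhs.
apply: filterS (filterI nI (cinv _ nS)) => y [[q Dq <-]] /=.
by rewrite chart_mapK // => Sq; exists q.
Qed.

End charts.

Section canonical_bases.
Local Open Scope classical_set_scope.
Context {R : realType} {n : nat} {M : manifold R n}.
Variables (g : riemannian_metric M).
Variable E : chart_index M -> 'rV[R]_n -> {vspace 'M[R]_n}.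

(** The space-form identity is stated for fields smooth on the whole domain of a
    canonical basis, whereas the vertical fields are smooth on the domain of the
    local expression of pi: both are restricted to the intersection. *)
Lemma canonical_basis_sub i W W' J : open W' -> W' `<=` W ->
  canonical_basis g E i W J -> canonical_basis g E i W' J.
Proof.
move=> oW' sW [_ WI sJ HJ]; split=> //.
- exact: subset_trans sW WI.
- by move=> a l; exact: Ck_sub sW (sJ a l).
- by move=> x /sW; exact: HJ.
Qed.

End canonical_bases.

Unset Implicit Arguments.

Theorem theorem3p1 (R : realType) (m k r : nat)
    (M : manifold R (4 * m)) (gM : riemannian_metric M)
    (E : chart_index M -> 'rV[R]_(4 * m) -> {vspace 'M[R]_(4 * m)}) (c : R)
    (hM : quaternionic_space_form gM E c)
    (N : manifold R k) (gN : riemannian_metric N) (pi : M -> N)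
    (hpi : riemannian_submersion gM gN pi)
    (hanti : anti_invariant gM pi E)
    (hr : forall i j x, local_dom pi i j x ->
       \rank (vert (local_map pi i j) x) = r)
    (e : chart_index M -> 'rV[R]_(4 * m) -> 'I_r -> 'rV[R]_(4 * m))
    (he : forall i j x, local_dom pi i j x ->
       orthonormal_vframe (gM i) (local_map pi i j) x (e i x)) :
  (forall i j x, local_dom pi i j x ->
     let f := local_map pi i j in
     forall u : 'rV[R]_(4 * m), (u <= vert f x)%MS -> inner (gM i x) u u = 1 ->
     hatRic (gM i) f x (e i x) u >=
       c / 4 * (r%:R - 1)
       - r%:R * inner (gM i x) (tensorT (gM i) f x u u)
                               (mean_curvature (gM i) f x (e i x)))
  /\
  ((forall i j x, local_dom pi i j x ->
      let f := local_map pi i j in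
      forall u : 'rV[R]_(4 * m), (u <= vert f x)%MS -> inner (gM i x) u u = 1 ->
      hatRic (gM i) f x (e i x) u =
        c / 4 * (r%:R - 1)
        - r%:R * inner (gM i x) (tensorT (gM i) f x u u)
                                (mean_curvature (gM i) f x (e i x)))
   <-> totally_geodesic_fibers gM pi).
Proof.
have [_ [cpi smpi] _ hsub] := hpi.
have oD i j : open (local_dom pi i j) by exact: open_local_dom.
have sG i j : smooth_on (local_dom pi i j) (gM i).
  by move=> l; apply: Ck_sub (gmx_smooth gM i l); exact: local_dom_image.
have G_sym i j x : local_dom pi i j x -> (gM i x)^T = gM i x.
  by move=> /local_dom_image; exact: gmx_sym.
have G_pos i j x : local_dom pi i j x ->
    forall u : 'rV[R]_(4 * m), u != 0 -> 0 < inner (gM i x) u u.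
  by move=> /local_dom_image; exact: gmx_pos.
have rkf i j x : local_dom pi i j x -> \rank ('J (local_map pi i j) x) = k.
  by move=> Dx; have [] := hsub i j x Dx.
have ric_formula i j x (Dx : local_dom pi i j x) u
    (ux : (u <= vert (local_map pi i j) x)%MS) (u1 : inner (gM i x) u u = 1) :
    hatRic (gM i) (local_map pi i j) x (e i x) u
    = c / 4 * (r%:R - 1)
      - r%:R * inner (gM i x) (tensorT (gM i) (local_map pi i j) x u u)
                (mean_curvature (gM i) (local_map pi i j) x (e i x))
      + \sum_a inner (gM i x)
          (tensorT (gM i) (local_map pi i j) x u (e i x a))
          (tensorT (gM i) (local_map pi i j) x u (e i x a)).
  have hex := he i j x Dx; have [_ ev eE] := hex.
  apply: (hatRic_vframe (oD i j) (sG i j) (@G_sym i j) (@G_pos i j)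
    (smpi i j) (@rkf i j) Dx hex ux u1) => a U V.
  have [W [J [Wx canJ]]] := hM.1.1.2 i x (local_dom_image Dx).
  set W' := setI W (local_dom pi i j).
  have W'x : W' x by [].
  have oW : open W by case: canJ.
  have can' : canonical_basis gM E i W' J.
    by apply: canonical_basis_sub canJ; [exact: openI|exact: subIsetl].
  have sv v : smooth_on W' (vproj (gM i) (local_map pi i j) (cst v)).
    move=> l; apply: (@Ck_sub _ _ _ l (local_dom pi i j)).
      exact: subIsetr.
    exact: (smooth_vcst (oD i j) (sG i j) (@G_sym i j) (@G_pos i j) (smpi i j)
              (@rkf i j)).
  have UE : U x = u by exact: (vcstE (@G_sym i j) (@G_pos i j) Dx ux).
  have VE : V x = e i x a by exact: (vcstE (@G_sym i j) (@G_pos i j) Dx (ev a)).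
  rewrite (hM.2 i W' J can' U V V (sv u) (sv _) (sv _) x W'x) UE VE.
  have J0 b v w : (v <= vert (local_map pi i j) x)%MS ->
      (w <= vert (local_map pi i j) x)%MS ->
      inner (gM i x) (v *m J b x) w = 0.
    move=> vx wx; rewrite (inner_sym (@G_sym i j)) //.
    apply: (vert_horiz_orth (@G_sym i j) Dx wx).
    exact: (hanti i j W' J can').
  (* The three quaternionic terms pair a J-image of a vertical vector with a
     vertical vector. *)
  rewrite big1 => [|b _]; last first.
    by rewrite !J0 // mulr0 !scale0r subrr addr0.
  rewrite addr0 innerZl innerBl !innerZl eE eqxx u1.
  by rewrite (inner_sym (@G_sym i j) (e i x a) u Dx) mulr1 expr2.
have sq_ge0 i j x u v : local_dom pi i j x -> 0 <= inner (gM i x)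
    (tensorT (gM i) (local_map pi i j) x u v)
    (tensorT (gM i) (local_map pi i j) x u v).
  by move=> Dx; exact: (inner_ge0 (@G_pos i j)).
split.
  move=> i j x Dx f u ux u1; rewrite (ric_formula i j x Dx u ux u1) lerDl.
  by apply: sumr_ge0 => a _; exact: sq_ge0 Dx.
split=> [Heq i j x Dx|T0 i j x Dx f u ux u1]; last first.
  rewrite (ric_formula i j x Dx u ux u1) big1 ?addr0 // => a _.
  by rewrite T0 // inner0l.
have hex := he i j x Dx; have [_ ev eE] := hex.
have Tsym := tensorT_sym (oD i j) (sG i j) (@G_sym i j) (@G_pos i j)
  (smpi i j) (@rkf i j) Dx.
have Tframe := tensorT_eq0_vframe (oD i j) (sG i j) (@G_sym i j) (@G_pos i j)
  (smpi i j) (@rkf i j) Dx hex.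
apply: (tensorT_eq0 (oD i j) (sG i j) (@G_sym i j) (@G_pos i j)
  (smpi i j) (@rkf i j) Dx).
(* Apply the equality to the frame vectors themselves. *)
have Tee b a : tensorT (gM i) (local_map pi i j) x (e i x b) (e i x a) = 0.
  have e1 : inner (gM i x) (e i x b) (e i x b) = 1 by rewrite eE eqxx.
  have := Heq i j x Dx (e i x b) (ev b) e1.
  rewrite /= (ric_formula i j x Dx _ (ev b) e1) => /eqP.
  rewrite -subr_eq0 addrAC subrr add0r psumr_eq0; last first.
    by move=> l _; exact: sq_ge0 Dx.
  move=> /allP /(_ a (mem_index_enum a)) /= /eqP.
  exact: (inner_self_eq0 (@G_pos i j) Dx).
move=> u v ux vx; apply: (Tframe _ _ vx) => a.
by rewrite (Tsym _ _ ux (ev a)); apply: (Tframe _ _ ux) => b; exact: Tee.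
Qed.
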